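(* Let $n=1$, $1/2 \leq \alpha \leq 1$ and $0<r<\infty$. Let $s^{\max}_c(\alpha, \ell^{r,\infty})$ be the critical Sobolev exponent of the fractal sequential Schrödinger maximal estimate on $\mathbb R$. Then $$s^{\max}_c(\alpha, \ell^{r, \infty}) \geq \frac{1-\alpha}{2} + \min\Big( \frac{2\alpha - 1}{4}, \frac{r(2\alpha - 1)}{2r + \alpha} \Big).$$
   Context: The Schrödinger operator on $\mathbb R^n$ (here $n=1$) is $$e^{it\Delta}f(x) = \int_{\mathbb{R}^n} \widehat f(\xi) \, e^{ 2\pi i (x \cdot \xi + t|\xi|^2) } \, d\xi .$$ $H^s=H^s(\mathbb R^n)$ is the usual $L^2$-based Sobolev space. For $0<r<\infty$, a real sequence $(t_k)_{k\in\mathbb N}$ belongs to $\ell^{r,\infty}=\ell^{r,\infty}(\mathbb N)$ if and only if $$\sup_{\delta>0} \delta^r\, \#\{ k \in \mathbb N: |t_k| \geq \delta \} < \infty.$$ $\mathcal M_\alpha$ is the set of $\alpha$-dimensional measures on $\mathbb R^n$: non-negative Borel measures $\mu$ for which there is a constant $C_\mu$ such that $\mu (B(x,\rho)) \le C_\mu \rho^\alpha$ for all $x \in \mathbb R^n$ and $\rho > 0$. The fractal sequential maximal estimate in $H^s$ is the statement $$\int_{B(0,1)} \sup_{k}|e^{it_k\Delta}f(x) |^2 \, d\mu(x) \lesssim C_\mu \|f\|_{H^s}^2, \qquad \forall (t_k) \in \ell^{r,\infty}, \ \forall f \in H^s, \ \forall \mu \in \mathcal M_\alpha,$$ where the implicit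 constant is independent of $f$ and $\mu$ (it may depend on $n,\alpha,r,s$ and on the sequence $(t_k)$). Since $\mu$ may be singular, the estimate is understood as an a priori estimate for Schwartz functions $f$. The critical exponent is $$s^{\max}_c(\alpha, \ell^{r, \infty}) = \inf \{ \, s\ge 0 : \text{the fractal sequential maximal estimate in } H^s \text{ holds} \, \}.$$ *)

(* Defs.v *)
From HB Require Import structures.
From mathcomp Require Import all_boot all_order all_algebra.
From mathcomp Require Import complex.
From mathcomp Require Import all_classical all_reals all_analysis.
Import Order.TTheory GRing.Theory Num.Theory.
Import numFieldNormedType.Exports.

Set Implicit Arguments.
Unset Strict Implicit.
Unset Printing Implicit Defensive.

Local Open Scope classical_set_scope.
Local Open Scope ring_scope.
Local Open Scope complex_scope.

Section Schroedinger.
Context {R : realType}.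

Definition expi (theta : R) : R[i] := cos theta +i* sin theta.

Definition cintegral (g : R -> R[i]) : R[i] :=
  Rintegral lebesgue_measure setT (fun x => complex.Re (g x)) +i*
  Rintegral lebesgue_measure setT (fun x => complex.Im (g x)).

Definition schwartzR (g : R -> R) : Prop :=
  (forall (m : nat) (x : R), derivable (derive1n m g) x 1) /\
  (forall j m : nat, exists M : R, forall x : R, `|x ^+ j * derive1n m g x| <= M).

Definition schwartz (f : R -> R[i]) : Prop :=
  schwartzR (fun x => complex.Re (f x)) /\ schwartzR (fun x => complex.Im (f x)).

Definition fourier (f : R -> R[i]) (xi : R) : R[i] :=
  cintegral (fun x => f x * expi (- (2 * pi * (x * xi)))).

Definition schroedinger (t : R) (f : R -> R[i]) (x : R) : R[i] :=
  cintegral (fun xi =>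
    fourier f xi * expi (2 * pi * (x * xi + t * `|xi| ^+ 2))).

Definition sobolev_normsq (s : R) (f : R -> R[i]) : \bar R :=
  (\int[lebesgue_measure]_(xi in [set: R])
    ((1 + `|xi| ^+ 2) `^ s * Normc.normc (fourier f xi) ^+ 2)%:E)%E.

(* [counting A] is +oo when A is infinite. *)
Definition weak_lr (r : R) (t : nat -> R) : Prop :=
  (ereal_sup [set (delta `^ r)%:E * counting [set k : nat | (delta <= `|t k|)%R]
             | delta in [set delta : R | (0 < delta)%R]] < +oo)%E.

(* C is an admissible constant C_mu; mu is alpha-dimensional when one exists. *)
Definition alpha_dim_with (alpha : R)
    (mu : {measure set (measurableTypeR R) -> \bar R}) (C : R) : Prop :=
  forall x rho : R, 0 < rho -> (mu (ball x rho) <= (C * rho `^ alpha)%:E)%E.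

(* The implicit constant A may depend on the sequence t, but not on f, mu, C. *)
Definition maximal_estimate (alpha r s : R) : Prop :=
  forall t : nat -> R, weak_lr r t ->
  exists2 A : R, 0 < A &
  forall (f : R -> R[i]) (mu : {measure set (measurableTypeR R) -> \bar R})
    (C : R),
    schwartz f -> alpha_dim_with alpha mu C ->
    (\int[mu]_(x in ball (0 : R)%R 1%R)
       ereal_sup (range (fun k : nat =>
         (Normc.normc (schroedinger (t k) f x) ^+ 2)%:E))
     <= A%:E * C%:E * sobolev_normsq s f)%E.

(* Taken in \bar R, so that the infimum of the empty set is +oo. *)
Definition s_max_crit (alpha r : R) : \bar R :=
  ereal_inf [set s%:E | s in [set s : R | 0 <= s /\ maximal_estimate alpha r s]].

End Schroedinger.

(* Main.v *)
Require Import Defs.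
From mathcomp Require Import all_boot all_order all_algebra.
From mathcomp Require Import complex.
From mathcomp Require Import all_classical all_reals all_analysis.
From mathcomp Require Import measurable_realfun.
From mathcomp Require Import ring lra.
Import Order.TTheory GRing.Theory Num.Theory.
Import numFieldNormedType.Exports.

(** The estimate is refuted for every [s] below the bound by testing it on a
    Gaussian wave packet and on a measure carried by the places where the packet
    focuses.

    The packet of width [lam] and frequency [N] has Fourier transform
    [exp (- pi (xi - N)^2 / lam^2)] ([fourier_packet]).  At time [t], with
    [|t| <= 1 / (64 lam^2)], its evolution has modulus at least [lam / 2] on the
    interval of half-width [1 / (64 lam)] around [- 2 N t]
    ([schroedinger_packet_ge]), while the square of its Sobolev norm is
    [O(N^(2 s) lam)] ([sobolev_packet_le]).  Taking [M] equally spaced times makes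
    the packet focus on [M] equally spaced intervals, the teeth of a comb.
    Lebesgue measure restricted to the comb is [alpha]-dimensional with a constant
    computed in [comb_alpha_dim], and it gives the left-hand side of the estimate
    at least [(lam / 2)^2] times the total length of the teeth
    ([comb_integral_ge]).

    Put [p = min r (alpha / 2)]; this is where the minimum of the statement comes
    from, since the bound for [r >= alpha / 2] is its value at [r = alpha / 2].
    At scale [X] there are [M = X^p] times with spacing [X^(-1-p) / 64], and
    [lam = X^(1/2)], [N = X^(p / alpha + 1/2)].  The choice of [N] balances the
    two terms in the constant of the comb, which is then
    [O(X^(- (1 - alpha) / 2))] ([comb_constant_le]), and [p <= alpha / 2] keeps
    all the teeth in the unit ball.  The estimate becomes a bound, uniform in [X],
    on [X] to the power [p + (1 - alpha) / 2 - s (2 p / alpha + 1)]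
    ([maximal_estimate_scale]), so this exponent cannot be positive, which is the
    claimed lower bound for [s].

    A single sequence serves all the scales [X = 2^(i / p)]: its [i]-th block, made
    of the indices [2^i <= k < 2^(i+1)], lists the [2^i = X^p] times of the scale.
    Its terms are [O(k^(- 1 / p))], so that it is in weak [l^p], hence in weak
    [l^r] ([weak_lr_tseq]). *)

Set Implicit Arguments.
Unset Strict Implicit.
Unset Printing Implicit Defensive.
Local Open Scope classical_set_scope.
Local Open Scope ring_scope.

(** * Gaussians and their integrals *)

Section gauss.
Context {R : realType}.
Implicit Types (a b m x u v t y : R).
Local Notation leb := (@lebesgue_measure R).

(** Gaussian of height one centred at [m], of rate [a]. *)
Definition gaussian a m x : R := expR (- (a * (x - m) ^+ 2)).

Lemma gaussian_ge0 a m x : 0 <= gaussian a m x.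
Proof. exact: expR_ge0. Qed.

Lemma gaussian_normal_pdf a m : 0 < a ->
  gaussian a m = (fun x => Num.sqrt (pi / a) *
    normal_pdf m (Num.sqrt (2 * a))^-1 x).
Proof.
move=> a0; have s0 : 0 < Num.sqrt (2 * a) by rewrite sqrtr_gt0; lra.
have s2 : (Num.sqrt (2 * a))^-1 ^+ 2 = (2 * a)^-1 :> R.
  by rewrite exprVn sqr_sqrtr//; lra.
apply/funext => x; rewrite normal_pdfE ?gt_eqF ?invr_gt0//.
rewrite /normal_peak s2 /normal_fun s2 mulrA.
rewrite -mulr_natr (_ : (2 * a)^-1 * pi * 2 = pi / a); last by field; lra.
rewrite divff ?mul1r; last first.
  by rewrite gt_eqF// sqrtr_gt0 divr_gt0// pi_gt0.
by rewrite /gaussian; congr expR; rewrite -mulr_natr; field; lra.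
Qed.

Lemma integrable_gaussian a m : 0 < a ->
  leb.-integrable [set: R] (EFin \o gaussian a m).
Proof.
move=> a0; rewrite gaussian_normal_pdf//=.
apply: (@eq_integrable _ _ _ leb _ measurableT (fun x => (Num.sqrt (pi / a))%:E *
   (normal_pdf m (Num.sqrt (2 * a))^-1 x)%:E)%E) => //.
apply: integrableZl => //; exact: integrable_normal_pdf.
Qed.

Lemma integral_gaussian a m : 0 < a ->
  (\int[leb]_(x in [set: R]) (gaussian a m x)%:E = (Num.sqrt (pi / a))%:E)%E.
Proof.
move=> a0; rewrite gaussian_normal_pdf//.
under eq_integral do rewrite EFinM.
rewrite integralZl//; last exact: integrable_normal_pdf.
by rewrite integral_normal_pdf mule1.
Qed.

Lemma Rintegral_gaussian a m : 0 < a ->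
  Rintegral leb [set: R] (gaussian a m) = Num.sqrt (pi / a).
Proof. by move=> a0; rewrite /Rintegral integral_gaussian. Qed.

Lemma is_derive_continuous (g g' : R -> R) :
  (forall x, is_derive x 1 g (g' x)) -> continuous g.
Proof.
by move=> dg x; apply/differentiable_continuous/derivable1_diffP; case: (dg x).
Qed.

Lemma is_derive_affine b c x : is_derive x 1 (fun x => b * x + c) b.
Proof.
rewrite (_ : (fun _ => _) = b \*: id + cst c)//.
by apply: trigger_derive; rewrite addr0 [_ *: _]mulr1.
Qed.

Lemma is_derive_gaussian a m x :
  is_derive x 1 (gaussian a m) (- (2 * a * (x - m)) * gaussian a m x).
Proof.
rewrite (_ : gaussian a m = expR \o (- (a \*: ((fun x => 1 * x + - m) ^+ 2)))); last first.
  by apply/funext => y; rewrite /gaussian !fctE/= mul1r.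
have h := is_derive_affine 1 (- m) x.
have h2 : is_derive x 1 (- (a \*: ((fun x => 1 * x + - m) ^+ 2))) (- (2 * a * (x - m))).
  by apply: trigger_derive; rewrite /GRing.scale/=; ring.
by apply: trigger_derive; rewrite mulrC.
Qed.

Lemma is_derive_cos_affine b c x :
  is_derive x 1 (fun x => cos (b * x + c)) (- b * sin (b * x + c)).
Proof.
have h := is_derive_affine b c x.
rewrite (_ : (fun _ => _) = cos \o (fun x => b * x + c))//.
by apply: trigger_derive; rewrite /=; ring.
Qed.

Lemma is_derive_sin_affine b c x :
  is_derive x 1 (fun x => sin (b * x + c)) (b * cos (b * x + c)).
Proof.
have h := is_derive_affine b c x.
rewrite (_ : (fun _ => _) = sin \o (fun x => b * x + c))//.
by apply: trigger_derive; rewrite /=; ring.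
Qed.

Lemma continuous_gaussian a m : continuous (gaussian a m).
Proof. exact: is_derive_continuous (is_derive_gaussian _ _). Qed.

Lemma continuous_cos_affine b c : continuous (fun x => cos (b * x + c)).
Proof. exact: is_derive_continuous (is_derive_cos_affine _ _). Qed.

Lemma continuous_sin_affine b c : continuous (fun x => sin (b * x + c)).
Proof. exact: is_derive_continuous (is_derive_sin_affine _ _). Qed.

(** The integrability criterion used throughout. *)
Lemma gaussian_dominated_integrable a m (K : R) (g : R -> R) : 0 < a ->
  measurable_fun setT g -> (forall x, `|g x| <= K * gaussian a m x) ->
  leb.-integrable [set: R] (EFin \o g).
Proof.
move=> a0 mg gK; apply: (@le_integrable _ _ _ leb _ measurableT _
  (fun x => K%:E * (gaussian a m x)%:E)%E) => //.
- exact/measurable_EFinP.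
- move=> x _ /=; rewrite lee_fin; exact: le_trans (gK x) (ler_norm _).
- by apply: integrableZl => //; exact: integrable_gaussian.
Qed.

(** A derivative that is integrable on the line has integral zero when the
    primitive vanishes at both infinities. *)
Lemma Rintegral_derive_eq0 (h h' : R -> R) :
  (forall x, is_derive x 1 h (h' x)) -> continuous h' ->
  leb.-integrable [set: R] (EFin \o h') ->
  h n%:R @[n --> \oo] --> 0 -> h (- n%:R) @[n --> \oo] --> 0 ->
  Rintegral leb [set: R] h' = 0.
Proof.
move=> dh ch' ih' hy hNy.
pose I n := `[(- n.+1%:R : R), n.+1%:R]%classic.
have ftc n : (\int[leb]_(x in I n) (h' x)%:E = (h n.+1%:R - h (- n.+1%:R))%:E)%E.
  rewrite (@continuous_FTC2 _ h' h) ?EFinB//.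
  - by rewrite gtrN// ltr0n.
  - exact: continuous_subspaceT.
  - have ch := is_derive_continuous dh.
    split; first by move=> x _; case: (dh x).
      exact/cvg_at_right_filter/ch.
    exact/cvg_at_left_filter/ch.
  - by move=> x _; rewrite derive1E; case: (dh x).
have cv1 : (\int[leb]_(x in setT) ((h' \_ (I n)) x)%:E @[n --> \oo] -->
    \int[leb]_(x in setT) (h' x)%:E)%E.
  apply: (@dominated_cvg _ _ _ leb _ measurableT _ _ (fun x => `|(h' x)%:E|%E)) => //.
  - move=> n; apply/measurable_EFinP.
    have mI : measurable (I n) by exact: measurable_itv.
    have mh := measurable_funTS (continuous_measurable_fun ch') (D := I n).
    exact: ((measurable_restrictT h' mI).1 mh).
  - move=> x _; apply: cvg_near_cst.
    exists (Num.truncn `|x|) => // n /= xn; rewrite patchE ifT// inE /I /= in_itv/=.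
    have : `|x| <= n.+1%:R.
      apply: le_trans (ltW (truncnS_gt _)) _.
      by rewrite ler_nat ltnS.
    by rewrite ler_norml.
  - exact: integrable_abse.
  - move=> n x _; rewrite lee_fin patchE; case: ifP => //= _.
    by rewrite normr0.
have cv2 : (\int[leb]_(x in setT) ((h' \_ (I n)) x)%:E @[n --> \oo] --> 0%:E)%E.
  rewrite (_ : (fun _ => _) = fun n => (h n.+1%:R - h (- n.+1%:R))%:E); last first.
    apply/funext => n; rewrite -ftc [RHS]integral_mkcond.
    by apply: eq_integral => x _; rewrite !patchE; case: ifP.
  apply: cvg_EFin; first exact: nearW.
  rewrite -(subr0 (0 : R)); apply: cvgB.
    by rewrite (cvg_shiftS (fun n => h n%:R)).
  by rewrite (cvg_shiftS (fun n => h (- n%:R))).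
by rewrite /Rintegral (cvg_unique _ cv1 cv2).
Qed.

End gauss.

(** * Fourier transform of a Gaussian *)

Section gaussian_fourier.
Context {R : realType}.
Implicit Types (a b c x : R).
Local Notation leb := (@lebesgue_measure R).

(** The factor [`|x|] is absorbed by halving the rate. *)
Lemma absM_gaussian_le a x : 0 < a ->
  `|x| * gaussian a 0 x <= (1 + 2 / a) * gaussian (a / 2) 0 x.
Proof.
move=> a0; rewrite /gaussian subr0.
rewrite (_ : - (a * x ^+ 2) = - (a / 2 * x ^+ 2) + - (a / 2 * x ^+ 2)); last by field.
rewrite expRD mulrA ler_wpM2r ?expR_ge0// expRN ler_pdivrMr ?expR_gt0//.
have h1 : 1 + a / 2 * x ^+ 2 <= expR (a / 2 * x ^+ 2) by exact: expR_ge1Dx.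
have h2 : `|x| <= 1 + x ^+ 2.
  by rewrite -(real_normK (num_real x)); nra.
apply: (le_trans h2); apply: (le_trans (y := (1 + 2 / a) * (1 + a / 2 * x ^+ 2))).
  rewrite [leRHS](_ : _ = 1 + x ^+ 2 + (2 / a + a / 2 * x ^+ 2)); last by field; lra.
  rewrite lerDl; apply: addr_ge0; first by rewrite divr_ge0// ltW.
  by rewrite mulr_ge0 ?sqr_ge0// divr_ge0// ltW.
by rewrite ler_wpM2l// addr_ge0// divr_ge0// ltW.
Qed.

Lemma gaussian_nat_le a n : 0 < a -> gaussian a 0 n%:R <= expR (- a) ^+ n :> R.
Proof.
move=> a0; rewrite /gaussian subr0 -expRM_natl ler_expR mulrN lerN2 [a * _]mulrC.
rewrite -natrX ler_wpM2r ?(ltW a0)// ler_nat.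
by case: n => // n; rewrite leq_pmull.
Qed.

Lemma cvg_gaussian_nat a (g : nat -> R) : 0 < a ->
  (forall n, `|g n| <= gaussian a 0 n%:R) -> g n @[n --> \oo] --> 0.
Proof.
move=> a0 gle; apply: norm_cvg0.
apply: (@squeeze_cvgr _ _ _ _ (cst 0) (fun n => expR (- a) ^+ n)).
- by apply: nearW => n; rewrite normr_ge0/= (le_trans (gle n))// gaussian_nat_le.
- exact: cvg_cst.
- by apply: cvg_expr; rewrite ger0_norm ?expR_ge0// expR_lt1; lra.
Qed.

Lemma gaussian_cos_integrable a m b c : 0 < a ->
  leb.-integrable [set: R] (EFin \o (fun x => gaussian a m x * cos (b * x + c))).
Proof.
move=> a0; apply: (@gaussian_dominated_integrable _ a m 1) => //.
  apply: measurable_funM; apply: continuous_measurable_fun.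
    exact: continuous_gaussian.
  exact: continuous_cos_affine.
move=> x; rewrite normrM mul1r ger0_norm ?gaussian_ge0//.
by rewrite ler_piMr ?gaussian_ge0// cos_max.
Qed.

Lemma Xgaussian_sin_integrable a b c : 0 < a ->
  leb.-integrable [set: R] (EFin \o (fun x => x * gaussian a 0 x * sin (b * x + c))).
Proof.
move=> a0; apply: (@gaussian_dominated_integrable _ (a / 2) 0 (1 + 2 / a)).
- by rewrite divr_gt0.
- do 2?apply: measurable_funM => //; apply: continuous_measurable_fun.
    exact: continuous_gaussian.
  exact: continuous_sin_affine.
move=> x; apply: le_trans (absM_gaussian_le x a0).
rewrite 2!normrM (ger0_norm (gaussian_ge0 _ _ _)) ler_piMr ?sin_max//.
by rewrite mulr_ge0 ?gaussian_ge0.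
Qed.

(** Integration by parts: the derivative of
    [gaussian a 0 x * sin (b * x + c)] has integral zero. *)
Lemma Rintegral_Xgaussian_sin a b c : 0 < a ->
  Rintegral leb [set: R] (fun x => x * gaussian a 0 x * sin (b * x + c)) =
  b / (2 * a) * Rintegral leb [set: R] (fun x => gaussian a 0 x * cos (b * x + c)).
Proof.
move=> a0.
pose h x := gaussian a 0 x * sin (b * x + c).
pose h' x := b * (gaussian a 0 x * cos (b * x + c)) -
  2 * a * (x * gaussian a 0 x * sin (b * x + c)).
have i1 := gaussian_cos_integrable 0 b c a0.
have i2 := Xgaussian_sin_integrable b c a0.
have i1' : leb.-integrable [set: R] (EFin \o (fun x => b * (gaussian a 0 x * cos (b * x + c)))).
  by have := integrableZl measurableT b i1.
have i2' : leb.-integrable [set: R] (EFin \o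
    (fun x => 2 * a * (x * gaussian a 0 x * sin (b * x + c)))).
  by have := integrableZl measurableT (2 * a) i2.
have : Rintegral leb [set: R] h' = 0.
  apply: (@Rintegral_derive_eq0 _ h).
  - move=> x; have d1 := is_derive_gaussian a 0 x.
    have d2 := is_derive_sin_affine b c x.
    rewrite (_ : h = gaussian a 0 * (fun x => sin (b * x + c)))//.
    by apply: trigger_derive; rewrite /h' /GRing.scale/= subr0; ring.
  - move=> x; apply: cvgB; apply: cvgM; try exact: cvg_cst.
      by apply: cvgM; [exact: continuous_gaussian|exact: continuous_cos_affine].
    apply: cvgM; last exact: continuous_sin_affine.
    by apply: cvgM; [exact: cvg_id|exact: continuous_gaussian].
  - by have := integrableB measurableT i1' i2'.
  - apply: (cvg_gaussian_nat a0) => n; rewrite normrM ger0_norm ?gaussian_ge0//.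
    by rewrite ler_piMr ?gaussian_ge0// sin_max.
  - apply: (cvg_gaussian_nat a0) => n; rewrite normrM ger0_norm ?gaussian_ge0//.
    by rewrite (_ : gaussian a 0 (- n%:R) = gaussian a 0 n%:R)
       ?ler_piMr ?gaussian_ge0 ?sin_max// /gaussian !subr0 sqrrN.
rewrite /h' RintegralB// !RintegralZl// => /eqP; rewrite subr_eq0 => /eqP h0.
by rewrite mulrAC h0; field; lra.
Qed.

(** Differentiation under the integral sign turns the transform into the solution
    of a linear first-order equation. *)
Lemma is_derive_gaussian_fourier a b c : 0 < a ->
  is_derive b 1 (fun b => Rintegral leb [set: R] (fun x => gaussian a 0 x * cos (b * x + c)))
   (- (b / (2 * a)) * Rintegral leb [set: R] (fun x => gaussian a 0 x * cos (b * x + c))).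
Proof.
move=> a0.
pose f b x := gaussian a 0 x * cos (b * x + c).
have df y x : is_derive (y : R) 1 (f ^~ x) (- (x * gaussian a 0 x * sin (y * x + c))).
  have d := is_derive_cos_affine x c y.
  rewrite (_ : f ^~ x = gaussian a 0 x \*: (fun y => cos (x * y + c))); last first.
    by apply/funext => z; rewrite /f [z * x]mulrC.
  by apply: trigger_derive; rewrite /GRing.scale/= [x * y]mulrC; ring.
have d1 y x : partial1of2 f y x = - (x * gaussian a 0 x * sin (y * x + c)).
  by rewrite partial1of2E; case: (df y x).
pose G x := (1 + 2 / a) * gaussian (a / 2) 0 x.
have a20 : 0 < a / 2 by rewrite divr_gt0.
have Ib : `]b - 1, b + 1[%classic b by rewrite /= in_itv/=; apply/andP; split; lra.
have intf y : `]b - 1, b + 1[%classic y -> leb.-integrable [set: R] (EFin \o f y).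
  by move=> _; exact: gaussian_cos_integrable.
have derf y x : `]b - 1, b + 1[%classic y -> [set: R] x -> derivable (f ^~ x) y 1.
  by move=> _ _; case: (df y x).
have G0 y : 0 <= G y.
  by rewrite mulr_ge0 ?gaussian_ge0// addr_ge0// divr_ge0// ltW.
have intG : leb.-integrable [set: R] (EFin \o G).
  by have := integrableZl measurableT (1 + 2 / a) (integrable_gaussian 0 a20).
have Gub y x : `]b - 1, b + 1[%classic y -> [set: R] x -> `|partial1of2 f y x| <= G x.
  move=> _ _; rewrite d1 normrN.
  apply: le_trans (absM_gaussian_le x a0).
  rewrite 2!normrM (ger0_norm (gaussian_ge0 _ _ _)) ler_piMr ?sin_max//.
  by rewrite mulr_ge0 ?gaussian_ge0.
apply: DeriveDef.
  exact: (derivable_under_integral measurableT Ib intf derf G0 intG Gub).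
rewrite -derive1E (differentiation_under_integral measurableT Ib intf derf G0 intG Gub).
under eq_Rintegral do rewrite d1 -mulN1r.
rewrite RintegralZl//; last exact: Xgaussian_sin_integrable.
by rewrite Rintegral_Xgaussian_sin// mulN1r mulNr.
Qed.

(** The Fourier transform of a Gaussian; the phase [c] treats cosine and sine
    at once. *)
Lemma Rintegral_gaussian_cos a b c : 0 < a ->
  Rintegral leb [set: R] (fun x => gaussian a 0 x * cos (b * x + c)) =
  cos c * Num.sqrt (pi / a) * gaussian (4 * a)^-1 0 b.
Proof.
move=> a0.
pose F b := Rintegral leb [set: R] (fun x => gaussian a 0 x * cos (b * x + c)).
rewrite -/(F b).
(* an integrating factor: its rate is the opposite of that of the solution *)
have dFE y : is_derive (y : R) 1 (F * gaussian (- (4 * a)^-1) 0) 0.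
  have d1 : is_derive y 1 F (- (y / (2 * a)) * F y) := is_derive_gaussian_fourier y c a0.
  have d2 := is_derive_gaussian (- (4 * a)^-1) 0 y.
  apply: trigger_derive; rewrite /GRing.scale/= subr0; field; lra.
have FE : F b * gaussian (- (4 * a)^-1) 0 b = F 0.
  have := @is_derive_0_is_cst _ _ b 0 dFE; rewrite !fctE => ->.
  by rewrite /gaussian subr0 expr0n/= mulr0 oppr0 expR0 mulr1.
have F0 : F 0 = cos c * Num.sqrt (pi / a).
  rewrite /F; under eq_Rintegral do rewrite mul0r add0r.
  by rewrite RintegralZr ?Rintegral_gaussian//; [rewrite mulrC|exact: integrable_gaussian].
rewrite -F0 -FE -mulrA /gaussian subr0 -expRD.
by rewrite mulNr opprK subrr expR0 mulr1.
Qed.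

End gaussian_fourier.

(** * Schwartz decay of Gaussian waves *)

Section wave_packet.
Context {R : realType}.
Implicit Types (a b c x s t : R) (lam N xi : R).
Local Notation leb := (@lebesgue_measure R).

Lemma poly_gaussian_bounded (p : {poly R}) a : 0 < a ->
  exists M, forall x, `|p.[x]| * gaussian a 0 x <= M.
Proof.
elim/poly_ind: p a => [|p c ih] a a0.
  by exists 0 => x; rewrite horner0 normr0 mul0r.
have a20 : 0 < a / 2 by rewrite divr_gt0.
have [M Mle] := ih (a / 2) a20.
exists ((1 + 2 / a) * M + `|c|) => x.
rewrite hornerMXaddC.
have g1 : gaussian a 0 x <= 1.
  by rewrite -expR0 ler_expR oppr_le0 mulr_ge0 ?sqr_ge0// ltW.
have g0 := gaussian_ge0 a 0 x.
apply: (le_trans (ler_wpM2r g0 (ler_normD _ _))).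
rewrite mulrDl lerD//; last by rewrite ler_piMr.
rewrite normrM -mulrA.
apply: (le_trans (ler_wpM2l (normr_ge0 _) (absM_gaussian_le x a0))).
by rewrite mulrCA ler_wpM2l// addr_ge0// divr_ge0// ltW.
Qed.

(** Gaussian times a trigonometric polynomial of frequency [b] with polynomial
    coefficients: a family closed under differentiation. *)
Definition poly_gaussian_wave a b c (p q : {poly R}) x :=
  (p.[x] * cos (b * x + c) + q.[x] * sin (b * x + c)) * gaussian a 0 x.

Lemma is_derive_gaussian_wave a b c (u v : R -> R) (u' v' x : R) :
  is_derive x 1 u u' -> is_derive x 1 v v' ->
  is_derive x 1 (fun x => (u x * cos (b * x + c) + v x * sin (b * x + c)) * gaussian a 0 x)
   (((u' + b * v x - 2 * a * (u x * x)) * cos (b * x + c) +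
     (v' - b * u x - 2 * a * (v x * x)) * sin (b * x + c)) * gaussian a 0 x).
Proof.
move=> du dv.
have d1 := is_derive_cos_affine b c x.
have d2 := is_derive_sin_affine b c x.
have d3 := is_derive_gaussian a 0 x.
have := is_deriveM (is_deriveD (is_deriveM du d1) (is_deriveM dv d2)) d3.
case=> d0 d0E; split; first exact: d0.
by rewrite [LHS]d0E /GRing.scale/= !fctE subr0; ring.
Qed.

Lemma is_derive_poly_gaussian_wave a b c p q x :
  is_derive x 1 (poly_gaussian_wave a b c p q)
   (poly_gaussian_wave a b c (p^`() + b *: q - (2 * a) *: (p * 'X))
      (q^`() - b *: p - (2 * a) *: (q * 'X)) x).
Proof.
have := is_derive_gaussian_wave a b c (is_derive_poly p x) (is_derive_poly q x).
by rewrite /poly_gaussian_wave !(hornerD, hornerN, hornerZ, hornerM, hornerX).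
Qed.

Lemma derive1n_poly_gaussian_wave a b c p q m : exists p' q',
  derive1n m (poly_gaussian_wave a b c p q) = poly_gaussian_wave a b c p' q'.
Proof.
elim: m => [|m [p' [q' ih]]]; first by exists p, q.
rewrite derive1nS ih; do 2 eexists; apply/funext => x.
by rewrite derive1E; case: (is_derive_poly_gaussian_wave a b c p' q' x) => _ ->.
Qed.

Lemma schwartzR_poly_gaussian_wave a b c p q : 0 < a ->
  schwartzR (poly_gaussian_wave a b c p q).
Proof.
move=> a0; split=> [m x|j m]; have [p' [q' ->]] := derive1n_poly_gaussian_wave a b c p q m.
  by case: (is_derive_poly_gaussian_wave a b c p' q' x).
have [M1 M1le] := poly_gaussian_bounded ('X^j * p') a0.
have [M2 M2le] := poly_gaussian_bounded ('X^j * q') a0.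
exists (M1 + M2) => x.
have h1 := M1le x; have h2 := M2le x.
rewrite hornerM hornerXn in h1; rewrite hornerM hornerXn in h2.
rewrite (_ : x ^+ j * _ = x ^+ j * p'.[x] * cos (b * x + c) * gaussian a 0 x +
    x ^+ j * q'.[x] * sin (b * x + c) * gaussian a 0 x); last first.
  by rewrite /poly_gaussian_wave; ring.
apply: (le_trans (ler_normD _ _)); apply: lerD.
  apply: le_trans h1; rewrite 2!(normrM (_ * _)) (ger0_norm (gaussian_ge0 _ _ _)).
  by rewrite ler_wpM2r ?gaussian_ge0// ler_piMr// cos_max.
apply: le_trans h2; rewrite 2!(normrM (_ * _)) (ger0_norm (gaussian_ge0 _ _ _)).
by rewrite ler_wpM2r ?gaussian_ge0// ler_piMr// sin_max.
Qed.

(** * The packet and its Fourier transform *)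

(** Real Gaussian wave of frequency width [lam], frequency [N] and phase [c]. *)
Definition wave lam N c x :=
  lam * gaussian (pi * lam ^+ 2) 0 x * cos (2 * pi * N * x + c).

(** The function [lam * exp (- pi lam^2 x^2) * exp (2 i pi N x)]; the sine in its
    imaginary part is the cosine of phase [- pi / 2]. *)
Definition packet lam N x : R[i] := (wave lam N 0 x +i* wave lam N (- (pi / 2)) x)%C.

Lemma cosB_pihalf x : cos (x - pi / 2) = sin x.
Proof. by rewrite cosB cos_pihalf sin_pihalf mulr0 add0r mulr1. Qed.

Lemma pilam_gt0 lam : 0 < lam -> 0 < pi * lam ^+ 2.
Proof. by move=> l0; rewrite mulr_gt0 ?pi_gt0// exprn_gt0. Qed.

Lemma schwartz_packet lam N : 0 < lam -> schwartz (packet lam N).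
Proof.
move=> l0; have h c : schwartzR (wave lam N c).
  rewrite (_ : wave lam N c = poly_gaussian_wave (pi * lam ^+ 2) (2 * pi * N) c lam%:P 0).
    by apply: schwartzR_poly_gaussian_wave; exact: pilam_gt0.
  apply/funext => x; rewrite /wave /poly_gaussian_wave hornerC horner0 mul0r addr0.
  by rewrite mulrAC.
by split; exact: h.
Qed.

Lemma packetM_expi lam N x xi :
  packet lam N x * expi (- (2 * pi * (x * xi))) =
  ((lam * (gaussian (pi * lam ^+ 2) 0 x * cos ((2 * pi * (N - xi)) * x + 0))) +i*
   (lam * (gaussian (pi * lam ^+ 2) 0 x * cos ((2 * pi * (N - xi)) * x + - (pi / 2)))))%C.
Proof.
rewrite /packet /expi /wave !addr0 !cosB_pihalf.
rewrite (_ : 2 * pi * (N - xi) * x = 2 * pi * N * x + - (2 * pi * (x * xi))); last by ring.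
rewrite cosD sinD; apply/eqP; rewrite eq_complex/=; apply/andP; split; apply/eqP; ring.
Qed.

Lemma fourier_packet lam N xi : 0 < lam ->
  fourier (packet lam N) xi = (gaussian (pi / lam ^+ 2) N xi)%:C%C.
Proof.
move=> l0; have pl0 := pilam_gt0 l0.
have pi0 : 0 < pi :> R := pi_gt0 R.
rewrite /fourier; under eq_fun do rewrite packetM_expi.
rewrite /cintegral/= !RintegralZl//; [|exact: gaussian_cos_integrable..].
rewrite !Rintegral_gaussian_cos// cosN cos_pihalf !mul0r mulr0 cos0 mul1r.
congr (_ +i* _)%C.
rewrite (_ : pi / (pi * lam ^+ 2) = (lam^-1) ^+ 2); last by field; lra.
rewrite sqrtr_sqr ger0_norm ?invr_ge0 ?ltW// mulrA divff ?gt_eqF// mul1r.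
rewrite /gaussian subr0; congr (expR (- _)); field; lra.
Qed.

(** * Lower bound for the evolution of the packet *)

(** A modulus dominates the real part of any rotation. *)
Lemma ler_normc_rot (A B th : R) : A * cos th + B * sin th <= Normc.normc (A +i* B)%C.
Proof.
apply: (le_trans (ler_norm _)); rewrite /= -sqrtr_sqr ler_wsqrtr//.
have := cos2Dsin2 th; set u := cos th; set v := sin th => uv.
have : 0 <= (A * v - B * u) ^+ 2 by exact: sqr_ge0.
by nra.
Qed.

Lemma cos_ge1Bnorm x : 1 - `|x| <= cos x.
Proof.
wlog x0 : x / 0 <= x.
  move=> h; have [|/ltW x0] := leP 0 x; first exact: h.
  by rewrite -normrN -cosN h// oppr_ge0.
rewrite ger0_norm//; have [->|xn0] := eqVneq x 0; first by rewrite cos0 subr0.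
have xp : 0 < x by rewrite lt_neqAle eq_sym xn0.
have [|y _] := @MVT R cos (fun x => - sin x) 0 x xp.
  by apply: continuous_subspaceT => y; exact: continuous_cos.
rewrite cos0 subr0 => e.
have : `|sin y| <= 1 by exact: sin_max.
rewrite ler_norml => /andP[_ h]; nra.
Qed.

Lemma realcM_expi (g th : R) : g%:C%C * expi th = ((g * cos th) +i* (g * sin th))%C.
Proof. by rewrite /expi; apply/eqP; rewrite eq_complex/= !mul0r subr0 addr0 !eqxx. Qed.

Lemma sqrt_le_sqr a b : 0 <= b -> a <= b ^+ 2 -> Num.sqrt a <= b.
Proof. by move=> b0 ab; rewrite -[leRHS]ger0_norm// -sqrtr_sqr ler_wsqrtr. Qed.

Lemma gaussian_weight_integrable a m (w : R -> R) : 0 < a ->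
  continuous w -> (forall x, `|w x| <= 1) ->
  leb.-integrable [set: R] (EFin \o (fun x => gaussian a m x * w x)).
Proof.
move=> a0 cw w1; apply: (@gaussian_dominated_integrable _ a m 1) => //.
  apply: measurable_funM; apply: continuous_measurable_fun => //.
  exact: continuous_gaussian.
move=> x; rewrite normrM mul1r ger0_norm ?gaussian_ge0//.
by rewrite ler_piMr ?gaussian_ge0.
Qed.

Lemma continuous_quad a b c : continuous (fun x => a * (b * x + c * x ^+ 2)).
Proof.
move=> x; apply: cvgM; first exact: cvg_cst.
apply: cvgD; apply: cvgM; try exact: cvg_cst; first exact: cvg_id.
exact: exprn_continuous.
Qed.

(** After removal of the constant phase at [xi = N], the integrand has phase
    [2 pi ((x + 2 N t) v + t v^2)] with [v = xi - N], which is small where the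
    Gaussian lives. *)
Lemma schroedinger_packet_ge lam N t x : 0 < lam ->
  `|x + 2 * N * t| <= 64^-1 / lam -> `|t| <= 64^-1 / lam ^+ 2 ->
  lam / 2 <= Normc.normc (schroedinger t (packet lam N) x).
Proof.
move=> l0 hx ht; have pi0 : 0 < pi :> R := pi_gt0 R.
have pi2 : 2 <= pi :> R by exact: pi_ge2.
have pi4 : pi <= 4 :> R by have := @pihalf_lt2 R; lra.
set a := pi / lam ^+ 2.
have l20 : 0 < lam ^+ 2 by exact: exprn_gt0.
have a0 : 0 < a by rewrite divr_gt0.
pose Phi xi := 2 * pi * (x * xi + t * xi ^+ 2).
have cPhi : continuous Phi by exact: continuous_quad.
have icos : leb.-integrable [set: R] (EFin \o (fun xi => gaussian a N xi * cos (Phi xi))).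
  apply: gaussian_weight_integrable => // [|y]; last exact: cos_max.
  by move=> y; apply: (continuous_comp (cPhi y)); exact: continuous_cos.
have isin : leb.-integrable [set: R] (EFin \o (fun xi => gaussian a N xi * sin (Phi xi))).
  apply: gaussian_weight_integrable => // [|y]; last exact: sin_max.
  by move=> y; apply: (continuous_comp (cPhi y)); exact: continuous_sin.
have -> : schroedinger t (packet lam N) x =
   (Rintegral leb [set: R] (fun xi => gaussian a N xi * cos (Phi xi)) +i*
    Rintegral leb [set: R] (fun xi => gaussian a N xi * sin (Phi xi)))%C.
  rewrite /schroedinger; under eq_fun do
    rewrite fourier_packet// real_normK ?num_real// realcM_expi.
  by [].
apply: le_trans (ler_normc_rot _ _ (Phi N)).
rewrite -!RintegralZr// -RintegralD//; last 2 first.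
- by have := integrableZr measurableT (cos (Phi N)) icos.
- by have := integrableZr measurableT (sin (Phi N)) isin.
(* The phase is at most [pi / 16 * exp (v^2 / lam^2)]; the exponential is absorbed
   by lowering the rate of the Gaussian from [pi / lam^2] to [b].  The loss is at
   most [pi / 16 * 2 lam <= lam / 2]. *)
set b := (pi - 1) / lam ^+ 2.
have b0 : 0 < b by rewrite divr_gt0//; lra.
have ia := integrable_gaussian N a0.
have ib := integrable_gaussian N b0.
have ib' : leb.-integrable [set: R] (EFin \o (fun xi => pi / 16 * gaussian b N xi)).
  by have := integrableZl measurableT (pi / 16) ib.
apply: (le_trans (y := Rintegral leb [set: R]
    (fun xi => gaussian a N xi - pi / 16 * gaussian b N xi))).
  rewrite RintegralB// RintegralZl// !Rintegral_gaussian//.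
  rewrite (_ : pi / a = lam ^+ 2); last by rewrite /a; field; lra.
  rewrite sqrtr_sqr (ger0_norm (ltW l0)).
  have : Num.sqrt (pi / b) <= 2 * lam.
    apply: sqrt_le_sqr; first by rewrite mulr_ge0// ltW.
    rewrite ler_pdivrMr// (_ : (2 * lam) ^+ 2 * b = 4 * (pi - 1)); first by lra.
    by rewrite /b; field; lra.
  by nra.
apply: le_Rintegral => //.
- by have := integrableB measurableT ia ib'.
- have := integrableD measurableT (integrableZr measurableT (cos (Phi N)) icos)
    (integrableZr measurableT (sin (Phi N)) isin).
  by [].
move=> xi _; rewrite -!mulrA -mulrDr -cosB.
set v := xi - N.
have -> : Phi xi - Phi N = 2 * pi * ((x + 2 * N * t) * v + t * v ^+ 2).
  by rewrite /Phi /v; ring.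
apply: (le_trans _ (ler_wpM2l (gaussian_ge0 _ _ _) (cos_ge1Bnorm _))).
rewrite mulrBr mulr1 lerB//.
have -> : gaussian b N xi = gaussian a N xi * expR (v ^+ 2 / lam ^+ 2).
  by rewrite /gaussian -expRD; congr expR; rewrite /a /b -/v; field; lra.
rewrite [leRHS](_ : _ = gaussian a N xi * (pi / 16 * expR (v ^+ 2 / lam ^+ 2))); last by field.
rewrite ler_wpM2l ?gaussian_ge0//.
set w := v / lam.
have vE : v = lam * w by rewrite /w; field; lra.
have -> : v ^+ 2 / lam ^+ 2 = w ^+ 2 by rewrite vE; field; lra.
have e1 : 1 + w ^+ 2 <= expR (w ^+ 2) by exact: expR_ge1Dx.
have w1 : `|w| <= 1 + w ^+ 2 by rewrite -(real_normK (num_real w)); nra.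
rewrite normrM ger0_norm ?mulr_ge0 ?(ltW pi0)//.
have h1 : `|(x + 2 * N * t) * v| <= 64^-1 * expR (w ^+ 2).
  rewrite normrM vE normrM (ger0_norm (ltW l0)) mulrA.
  apply: ler_pM => //; first by rewrite mulr_ge0// ltW.
    by rewrite -ler_pdivlMr.
  exact: le_trans w1 e1.
have h2 : `|t * v ^+ 2| <= 64^-1 * expR (w ^+ 2).
  rewrite normrM vE exprMn normrM (ger0_norm (ltW l20)) mulrA.
  apply: ler_pM => //; first by rewrite mulr_ge0// ltW.
    by rewrite -ler_pdivlMr.
  by rewrite ger0_norm ?sqr_ge0//; lra.
apply: (le_trans (ler_wpM2l _ (le_trans (ler_normD _ _) (lerD h1 h2)))).
  by rewrite mulr_ge0// ltW.
by rewrite le_eqVlt; apply/orP; left; apply/eqP; field.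
Qed.

(** * Sobolev norm of the packet *)

Lemma sobolev_packet_le lam N s : 0 < lam -> 1 <= N -> lam <= N -> 0 <= s <= 1 ->
  (sobolev_normsq s (packet lam N) <= (3 * N `^ (2 * s) * lam)%:E)%E.
Proof.
move=> l0 N1 lN /andP[s0 s1]; have pi0 : 0 < pi :> R := pi_gt0 R.
have pi2 : 2 <= pi :> R by exact: pi_ge2.
have l20 : 0 < lam ^+ 2 by exact: exprn_gt0.
set b := (2 * pi - 1) / lam ^+ 2.
have b0 : 0 < b by rewrite divr_gt0//; lra.
rewrite /sobolev_normsq.
(* The weight is at most [3 N^2 exp (v^2 / lam^2)] with [v = xi - N], and the
   exponential lowers the rate of the Gaussian from [2 pi / lam^2] to [b]. *)
have bnd xi : (1 + `|xi| ^+ 2) `^ s * Normc.normc (fourier (packet lam N) xi) ^+ 2 <=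
   3 * N `^ (2 * s) * gaussian b N xi.
  rewrite fourier_packet//= expr0n/= addr0 sqrtr_sqr real_normK ?num_real// real_normK ?num_real//.
  set w := ((xi - N) / lam) ^+ 2.
  have -> : gaussian b N xi = gaussian (pi / lam ^+ 2) N xi ^+ 2 * expR w.
    rewrite /gaussian -expRM_natl -expRD; congr expR; rewrite /b /w; field; lra.
  rewrite mulrA [leRHS]mulrAC ler_wpM2r ?sqr_ge0//.
  have w0 : 0 <= w by exact: sqr_ge0.
  have ew : 1 + w <= expR w by exact: expR_ge1Dx.
  have x1 : 1 + xi ^+ 2 <= 3 * N ^+ 2 * expR w.
    apply: (le_trans (y := 3 * N ^+ 2 * (1 + w))); last first.
      by rewrite ler_wpM2l// mulr_ge0 ?sqr_ge0.
    have e : lam ^+ 2 * w = (xi - N) ^+ 2 by rewrite /w; field; lra.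
    have e2 : lam ^+ 2 * w <= N ^+ 2 * w.
      by rewrite ler_wpM2r// lerXn2r ?nnegrE// ltW//; lra.
    have : 0 <= (xi - 2 * N) ^+ 2 by exact: sqr_ge0.
    have : 0 <= N ^+ 2 * w by rewrite mulr_ge0 ?sqr_ge0.
    by nra.
  apply: (le_trans (ge0_ler_powR s0 _ _ x1)); rewrite ?nnegrE ?addr_ge0 ?sqr_ge0//.
    by apply: mulr_ge0; [apply: mulr_ge0 => //; exact: sqr_ge0|exact: expR_ge0].
  have N20 : 0 <= N ^+ 2 by exact: sqr_ge0.
  rewrite (powRM s (mulr_ge0 _ N20) (expR_ge0 _))// (powRM s _ N20)//.
  apply: ler_pM; rewrite ?mulr_ge0 ?powR_ge0//.
    apply: ler_pM; rewrite ?powR_ge0//.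
      by rewrite -[leRHS]powRr1// ler_powR//; lra.
    by rewrite -powR_mulrn ?powRrM//; lra.
  by rewrite -expRM ler_expR ler_piMr.
apply: (le_trans (y := (\int[leb]_(xi in [set: R]) (3 * N `^ (2 * s) * gaussian b N xi)%:E)%E)).
  apply: ge0_le_integral => //.
  - move=> xi _; rewrite lee_fin mulr_ge0 ?powR_ge0 ?sqr_ge0//.
  - rewrite (_ : (fun _ => _) =
        (fun xi => ((1 + xi ^+ 2) `^ s * gaussian (pi / lam ^+ 2) N xi ^+ 2)%:E)); last first.
      apply/funext => xi; rewrite fourier_packet//= expr0n/= addr0 sqrtr_sqr.
      by rewrite !real_normK ?num_real.
    apply/measurable_EFinP/measurable_funM.
      by apply: (measurableT_comp (measurable_powR s)); exact: measurable_funD.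
    apply: measurable_funX.
    by apply: continuous_measurable_fun; exact: continuous_gaussian.
  - apply/measurable_EFinP/measurable_funM => //.
    by apply: continuous_measurable_fun; exact: continuous_gaussian.
  - by move=> xi _; rewrite lee_fin.
under eq_integral do rewrite EFinM.
rewrite integralZl//; last exact: integrable_gaussian.
rewrite integral_gaussian// -EFinM lee_fin ler_wpM2l ?mulr_ge0 ?powR_ge0//.
apply: (sqrt_le_sqr (ltW l0)).
rewrite /b ler_pdivrMr; last by rewrite divr_gt0//; lra.
by rewrite mulrCA divff ?gt_eqF// mulr1; lra.
Qed.

End wave_packet.

(** * The comb measure *)

Section comb.
Context {R : realType}.
Implicit Types (a b c x y s t rho alpha D l : R) (M i j n : nat).
Local Notation leb := (@lebesgue_measure R).

(** The integral of a nonnegative function is a supremum over the simple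
    functions below it, so monotonicity needs no measurability; the supremum over
    the times is thus bounded below without showing that it is measurable. *)
Lemma ge0_le_integral_arbitrary d (T : measurableType d)
    (mu : {measure set T -> \bar R}) (D : set T) (f1 f2 : T -> \bar R) :
  (forall x : T, D x -> (0 <= f1 x)%E) -> (forall x : T, D x -> (f1 x <= f2 x)%E) ->
  (\int[mu]_(x in D) f1 x <= \int[mu]_(x in D) f2 x)%E.
Proof.
move=> f10 f12.
have f20 (x : T) : D x -> (0 <= f2 x)%E by move=> Dx; exact: le_trans (f10 x Dx) (f12 x Dx).
rewrite !ge0_integralE//; apply: ereal_sup_le => _ [h hle <-]; exists h => // x.
apply: le_trans (hle x) _; rewrite !patchE; case: ifPn => //.
by rewrite inE; exact: f12.
Qed.

Lemma integral_ge_level d (T : measurableType d)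
    (mu : {measure set T -> \bar R}) (D B : set T) (K : R) (f : T -> \bar R) :
  measurable D -> measurable B -> B `<=` D -> 0 <= K ->
  (forall x : T, D x -> (0 <= f x)%E) -> (forall x : T, B x -> (K%:E <= f x)%E) ->
  (K%:E * mu B <= \int[mu]_(x in D) f x)%E.
Proof.
move=> mD mB BD K0 f0 Kf.
have <- : (\int[mu]_(x in D) (K%:E * (\1_B x)%:E) = K%:E * mu B)%E.
  rewrite ge0_integralZl_EFin//; last first.
    by apply/measurable_EFinP; apply: measurable_funTS; exact: measurable_indic.
  by rewrite integral_indic// setIidl.
apply: ge0_le_integral_arbitrary => x Dx.
  by rewrite -EFinM lee_fin mulr_ge0.
rewrite indicE; case: (boolP (x \in B)) => [|_].
  by rewrite inE mule1; exact: Kf.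
by rewrite mule0 f0.
Qed.

(** The [j]-th tooth has centre [- (j + 1) * D] and half-width [l]. *)
Definition tooth D l j : set R :=
  [set` `[- (j.+1%:R * D) - l, - (j.+1%:R * D) + l] ].

Lemma measurable_tooth D l j : measurable (tooth D l j : set (measurableTypeR R)).
Proof. exact: measurable_itv. Qed.

(** Sum of the Lebesgue measures restricted to the first [M] teeth. *)
Definition comb D l M : {measure set (measurableTypeR R) -> \bar R} :=
  msum (fun j => mrestr leb (measurable_tooth D l j)) M.

Lemma combE D l M (A : set (measurableTypeR R)) :
  comb D l M A = (\sum_(j < M) leb (A `&` tooth D l j))%E.
Proof. by []. Qed.

Lemma lebesgue_tooth D l j : 0 < l -> leb (tooth D l j) = (2 * l)%:E.
Proof.
move=> l0; rewrite /tooth lebesgue_measure_itv/= lte_fin ltrD2l gtrN//.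
by rewrite -EFinB; congr EFin; ring.
Qed.

Lemma comb_integral_ge D l M (K : R) (B : set R) (f : R -> \bar R) : 0 < l -> 0 <= K ->
  measurable (B : set (measurableTypeR R)) ->
  (forall j, (j < M)%N -> tooth D l j `<=` B) ->
  (forall x, (0 <= f x)%E) ->
  (forall j x, (j < M)%N -> tooth D l j x -> (K%:E <= f x)%E) ->
  ((K * (M%:R * (2 * l)))%:E <= \int[comb D l M]_(x in B) f x)%E.
Proof.
move=> l0 K0 mB subB f0 Kf.
pose U : set R := \bigcup_(j in `I_M) tooth D l j.
have mU : measurable (U : set (measurableTypeR R)).
  by apply: bigcup_measurable => j _; exact: measurable_tooth.
have <- : (K%:E * comb D l M U = (K * (M%:R * (2 * l)))%:E)%E.
  rewrite combE EFinM; congr (_ * _)%E.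
  rewrite (eq_bigr (fun=> (2 * l)%:E)); last first.
    move=> j _; rewrite setIidr; first exact: lebesgue_tooth.
    by move=> x xj; exists (val j) => //=.
  by rewrite sumEFin sumr_const card_ord -[_ *+ M]mulr_natl.
apply: integral_ge_level => //.
  by move=> x [j jM]; exact: subB.
by move=> x [j jM]; exact: Kf.
Qed.

Lemma ler_min_powR a b alpha : 0 < a -> 0 < b -> 0 <= alpha <= 1 ->
  Num.min a b <= a `^ alpha * b `^ (1 - alpha).
Proof.
move=> a0 b0 /andP[al0 al1]; set m := Num.min a b.
have m0 : 0 < m by rewrite lt_min a0.
have -> : m = m `^ alpha * m `^ (1 - alpha).
  by rewrite -powRD ?subrKC ?powRr1 ?ltW// gt_eqF// implybT.
by apply: ler_pM; rewrite ?powR_ge0//; apply: ge0_ler_powR;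
  rewrite ?subr_ge0 ?nnegrE ?(ltW m0) ?(ltW a0) ?(ltW b0)//= /m ge_min lexx ?orbT.
Qed.

(** A set of integers of diameter at most [d] has at most [d + 1] elements. *)
Lemma card_ord_diam M (P : pred 'I_M) (d : R) : 0 <= d ->
  (forall i j : 'I_M, P i -> P j -> (j%:R - i%:R : R) <= d) -> #|P|%:R <= d + 1.
Proof.
move=> d0 Pd; have [i0 Pi0|P0] := pickP P; last first.
  by rewrite (eq_card0 P0) addr_ge0.
case: (arg_minnP (fun i : 'I_M => val i) Pi0) => i Pi imin.
have : (#|P| <= (Num.truncn d).+1)%N.
  rewrite cardE -(size_map val) -[leqRHS](size_iota (val i)).
  apply: uniq_leq_size; first by rewrite map_inj_uniq ?enum_uniq//; exact: val_inj.
  move=> _ /mapP[j + ->]; rewrite mem_enum => Pj.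
  rewrite mem_iota imin//= addnS ltnS -leq_subLR.
  rewrite truncn_ge_nat// natrB; [exact: Pd|exact: imin].
rewrite -(ler_nat R) => /le_trans; apply.
by rewrite -natr1 lerD2r truncn_le.
Qed.

Lemma tooth_ball_le D l j x rho : 0 < l -> 0 < rho ->
  (leb (ball x rho `&` tooth D l j) <= (2 * Num.min rho l)%:E)%E.
Proof.
move=> l0 r0.
have mb : measurable (ball x rho : set (measurableTypeR R)) by exact: measurable_ball.
have mt := measurable_tooth D l j.
have mi := measurableI _ _ mb mt.
have h1 : (leb (ball x rho `&` tooth D l j) <= (2 * rho)%:E)%E.
  rewrite (_ : 2 * rho = rho *+ 2) ?mulr_natl//.
  by rewrite -(lebesgue_measure_ball x (ltW r0)) le_measure ?inE//; exact: subIsetl.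
have h2 : (leb (ball x rho `&` tooth D l j) <= (2 * l)%:E)%E.
  by rewrite -(lebesgue_tooth D j l0) le_measure ?inE//; exact: subIsetr.
by rewrite /Num.min; case: ifP.
Qed.

(** The first term of the constant comes from balls meeting a bounded number of
    teeth, the second from larger balls, which see the comb as a measure of
    density [l / D] on an interval of length [M * D]. *)
Lemma comb_alpha_dim D l M alpha : 0 < l -> l <= D -> 0 <= alpha <= 1 -> (0 < M)%N ->
  alpha_dim_with alpha (comb D l M)
    (6 * l `^ (1 - alpha) + 4 * l * (M%:R * D) `^ (1 - alpha) / D).
Proof.
move=> l0 lD al M0 x rho r0.
have D0 : 0 < D by exact: lt_le_trans lD.
have MR : 0 < M%:R :> R by rewrite ltr0n.
rewrite combE.
pose P := [pred j : 'I_M | `|x + j.+1%:R * D| <= rho + l].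
apply: (le_trans (y := (\sum_(j < M | j \in P) (2 * Num.min rho l)%:E)%E)).
  rewrite [leRHS]big_mkcond/=; apply: lee_sum => j _; case: ifPn => [_|Pj].
    exact: tooth_ball_le.
  rewrite (_ : _ `&` _ = set0) ?measure0//; apply/seteqP; split=> // y [].
  rewrite ball_itv /tooth /= !in_itv/= => /andP[y1 y2] /andP[y3 y4].
  by move/negP: Pj; apply; rewrite inE ler_norml; apply/andP; split; lra.
rewrite sumEFin sumr_const lee_fin -[_ *+ #|_|]mulr_natr.
have cM : #|P|%:R <= M%:R :> R by rewrite ler_nat -[leqRHS]card_ord max_card.
have cP : #|P|%:R <= 2 * rho / D + 3 :> R.
  apply: (le_trans (y := 2 * (rho + l) / D + 1)).
    apply: card_ord_diam => [|i j]; first by rewrite divr_ge0 ?mulr_ge0 ?addr_ge0 ?ltW.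
    rewrite !inE !ler_norml => /andP[i1 i2] /andP[j1 j2].
    rewrite ler_pdivlMr//.
    by rewrite -!natr1 in i1 i2 j1 j2; nra.
  have : l / D <= 1 by rewrite ler_pdivrMr// mul1r.
  by rewrite mulrDr mulrDl -mulrA; lra.
set m := Num.min rho l.
have m0 : 0 < m by rewrite lt_min r0.
have ml : m <= l by rewrite /m ge_min lexx orbT.
have mp : m <= rho `^ alpha * l `^ (1 - alpha) by exact: ler_min_powR.
have n1 : D * Num.min M%:R (2 * rho / D) <= 2 * (rho `^ alpha * (M%:R * D) `^ (1 - alpha)).
  apply: (le_trans (y := 2 * Num.min rho (M%:R * D))); last first.
    by rewrite ler_wpM2l// ler_min_powR// mulr_gt0.
  have MD : 0 < M%:R * D by rewrite mulr_gt0.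
  have : Num.min M%:R (2 * rho / D) <= M%:R by rewrite ge_min lexx.
  have : Num.min M%:R (2 * rho / D) <= 2 * rho / D by rewrite ge_min lexx orbT.
  rewrite ler_pdivlMr//; set n := Num.min M%:R _ => h1 h2.
  rewrite {1}/Num.min; case: ifP => _; [by rewrite mulrC|by nra].
have cmin : #|P|%:R <= Num.min M%:R (2 * rho / D) + 3 :> R.
  rewrite {1}/Num.min; case: ifP => _ //; lra.
have n0 : 0 <= Num.min M%:R (2 * rho / D).
  by rewrite le_min ler0n divr_ge0 ?mulr_ge0 ?ltW.
apply: (le_trans (ler_wpM2l _ cmin)); first by rewrite mulr_ge0// ltW.
set n := Num.min M%:R _ in n1 n0 *; set p := rho `^ alpha in mp n1 *.
set q := l `^ _ in mp *; set w := (M%:R * D) `^ _ in n1 *.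
have n2 : n <= 2 * (p * w) / D by rewrite ler_pdivlMr// mulrC.
apply: (le_trans (y := 6 * (p * q) + 2 * l * (2 * (p * w) / D))).
  rewrite mulrDr addrC; apply: lerD; first by lra.
  by apply: ler_pM => //; rewrite ?mulr_ge0 ?ler_wpM2l// ltW.
by rewrite le_eqVlt; apply/orP; left; apply/eqP; field; lra.
Qed.

End comb.

(** * The sequence of times *)

Section sequence.
Context {R : realType}.
Implicit Types (a b c x s t p r alpha X A : R) (i j k n : nat).

(** For [2 ^ i <= k < 2 ^ i.+1] the times [tseq p k] are the first [2 ^ i]
    positive multiples of [2 ^ (- i / p - i) / 64].  The value at [k = 0], which is
    in no block, is that at [k = 1]. *)
Definition tseq p k : R := (k - 2 ^ trunc_log 2 k).+1%:R *
  (64^-1 * (2 ^ trunc_log 2 k)%:R `^ (- p^-1) / (2 ^ trunc_log 2 k)%:R).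

Lemma tseqE p i j : (j < 2 ^ i)%N ->
  tseq p (2 ^ i + j) = j.+1%:R * (64^-1 * (2 ^ i)%:R `^ (- p^-1) / (2 ^ i)%:R).
Proof.
move=> ji; rewrite /tseq (@trunc_log_eq 2 i)//.
  by rewrite addKn.
by rewrite leq_addr/= expnS mul2n -addnn ltn_add2l.
Qed.

Lemma tseq_ge0 p k : 0 <= tseq p k.
Proof. by rewrite /tseq !mulr_ge0 ?powR_ge0. Qed.

Lemma tseq_le p k : tseq p k <= (2 ^ trunc_log 2 k)%:R `^ (- p^-1).
Proof.
rewrite /tseq; set n := (2 ^ trunc_log 2 k)%N.
have n0 : 0 < n%:R :> R by rewrite ltr0n expn_gt0.
have kn : (k - n).+1%:R <= n%:R :> R.
  rewrite ler_nat ltn_psubLR ?expn_gt0//.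
  by rewrite addnn -mul2n -expnS trunc_log_ltn.
rewrite mulrA ler_pdivrMr// mulrC; apply: ler_pM => //.
by rewrite ler_piMl ?powR_ge0//; lra.
Qed.

Lemma counting_le_nat (B : set nat) n : B `<=` `I_n ->
  (counting B <= (n%:R : R)%:E)%E.
Proof.
move=> Bn; have fB : finite_set B by exact: sub_finite_set (finite_II n).
rewrite /counting asboolT// lee_fin ler_nat; apply: geq_card_fset_set.
exact: subset_card_le.
Qed.

Lemma weak_lr_tseq p r : 0 < p -> p <= r -> weak_lr r (tseq p).
Proof.
move=> p0 pr; apply: (le_lt_trans (y := 3%:E)); last exact: ltry.
apply: ge_ereal_sup => _ [d /= d0 <-].
set B := [set k | _].
have [[k0 Bk0]|B0] := pselect (exists k, B k); last first.
  rewrite (_ : B = set0) ?measure0 ?mule0//.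
  by apply/seteqP; split => // k Bk; apply: B0; exists k.
have Bd k : B k -> (2 ^ trunc_log 2 k)%:R <= d `^ (- p).
  move=> /=; rewrite /B/= ger0_norm ?tseq_ge0// => dt.
  have n0 : 0 < (2 ^ trunc_log 2 k)%:R :> R by rewrite ltr0n expn_gt0.
  have := le_trans dt (tseq_le p k); rewrite !powRN => h.
  rewrite -[leLHS]invrK lef_pV2 ?posrE ?invr_gt0 ?powR_gt0//.
  have -> : (2 ^ trunc_log 2 k)%:R^-1 = ((2 ^ trunc_log 2 k)%:R `^ p^-1)^-1 `^ p :> R.
    by rewrite -powRN -powRrM mulNr mulVf ?gt_eqF// powR_inv1// ltW.
  by apply: ge0_ler_powR => //; rewrite ?nnegrE ?invr_ge0 ?powR_ge0// ltW.
have d1 : d <= 1.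
  have n1 : 1 <= (2 ^ trunc_log 2 k0)%:R :> R by rewrite ler1n expn_gt0.
  have := le_trans n1 (Bd _ Bk0); rewrite powRN => h.
  rewrite leNgt; apply/negP => d1.
  have : d `^ p <= 1 by rewrite -invr_ge1 ?unitfE ?posrE ?gt_eqF ?powR_gt0.
  have : 1 `^ p < d `^ p by apply: gt0_ltr_powR => //; rewrite nnegrE ltW.
  by rewrite powR1 => /lt_le_trans/[apply]; rewrite ltxx.
(* [tseq_le] and [k < 2 * 2 ^ trunc_log 2 k] give [k <= 2 * d `^ (- p)] on [B] *)
pose n := (Num.truncn (2 * d `^ (- p))).+1.
have cB : (counting B <= (n%:R : R)%:E)%E.
  apply: counting_le_nat => k Bk /=; rewrite /n ltnS truncn_ge_nat ?mulr_ge0 ?powR_ge0//.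
  apply: le_trans (ler_wpM2l _ (Bd k Bk)) => //.
  by rewrite -natrM ler_nat -expnS ltnW// trunc_log_ltn.
apply: (le_trans (lee_wpmul2l _ cB)); first by rewrite lee_fin powR_ge0.
rewrite -EFinM lee_fin /n -natr1.
have h1 : (Num.truncn (2 * d `^ (- p)))%:R <= 2 * d `^ (- p).
  by rewrite truncn_le// mulr_ge0 ?powR_ge0.
have h2 : d `^ r <= d `^ p.
  by apply: ger_powR => //; rewrite d0.
have h3 : d `^ p <= 1 by rewrite -(powRr0 d); apply: ger_powR => //; rewrite ?d0// ltW.
have h4 : d `^ p * d `^ (- p) = 1.
  by rewrite powRN divff// gt_eqF// powR_gt0.
have h5 : 0 <= d `^ p := powR_ge0 _ _.
have h6 : 0 <= d `^ r := powR_ge0 _ _.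
have h7 : 0 <= d `^ (- p) := powR_ge0 _ _.
apply: (le_trans (ler_pM h6 _ h2 (lerD h1 (lexx 1)))).
  by rewrite addr_ge0.
by rewrite mulrDr mulrCA h4; lra.
Qed.

End sequence.

(** * Parameters at scale X *)

Section lower_bound.
Context {R : realType}.
Implicit Types (a b c x s t p r alpha X A : R) (i j k n : nat).

Lemma powR_mul X a b : 0 < X -> X `^ a * X `^ b = X `^ (a + b).
Proof. by move=> X0; rewrite powRD// (gt_eqF X0) implybT. Qed.

(** Width of the packet in frequency. *)
Definition packet_width X := X `^ (1 / 2).

(** Frequency of the packet. *)
Definition packet_freq alpha p X := X `^ (p / alpha + 1 / 2).

(** Half-width of a tooth, see [tooth_widthE]. *)
Definition tooth_width X := 64^-1 * X `^ (- (1 / 2)).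

(** Distance between the centres of consecutive teeth, see [tooth_gapE]; there are
    [X `^ p] teeth. *)
Definition tooth_gap alpha p X := 32^-1 * X `^ (p / alpha - 1 / 2 - p).

Lemma powR_le1 X a : 1 <= X -> a <= 0 -> X `^ a <= 1.
Proof. by move=> X1 a0; rewrite -(powRr0 X) ler_powR. Qed.

Lemma powR_ge1 X a : 1 <= X -> 0 <= a -> 1 <= X `^ a.
Proof. by move=> X1 a0; rewrite -(powRr0 X) ler_powR. Qed.

Lemma powR_base_le1 a b : 0 <= a <= 1 -> 0 <= b -> a `^ b <= 1.
Proof.
move=> /andP[a0 a1] b0; apply: (le_trans (y := 1 `^ b)); last by rewrite powR1.
by apply: ge0_ler_powR => //; rewrite nnegrE.
Qed.

Lemma packet_width_sqr X : 0 < X -> packet_width X ^+ 2 = X.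
Proof. by move=> X0; rewrite expr2 powR_mul// -splitr powRr1// ltW. Qed.

Lemma tooth_widthE X : tooth_width X = 64^-1 / packet_width X.
Proof. by rewrite /tooth_width powRN. Qed.

Lemma mulr_tooth_gap alpha p X : 0 < X ->
  X `^ p * tooth_gap alpha p X = 32^-1 * X `^ (p / alpha - 1 / 2).
Proof. by move=> X0; rewrite /tooth_gap mulrCA powR_mul//; congr (_ * X `^ _); ring. Qed.

(** Times with gap [X^-1 / (64 X `^ p)] focus the packet at points with gap
    [tooth_gap]. *)
Lemma tooth_gapE alpha p X : 0 < X ->
  2 * packet_freq alpha p X * (64^-1 * X^-1 / X `^ p) = tooth_gap alpha p X.
Proof.
move=> X0; rewrite /packet_freq /tooth_gap -powRN -[X^-1]powR_inv1; last exact: ltW.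
rewrite [LHS](_ : _ = 32^-1 * (X `^ (p / alpha + 1 / 2) * X `^ (- 1) * X `^ (- p))).
  by rewrite !powR_mul//; congr (_ * X `^ _); set y := p / alpha; field.
by field.
Qed.

Lemma tooth_width_le_gap alpha p X : 1 <= X -> 0 < alpha <= 1 -> 0 < p ->
  tooth_width X <= tooth_gap alpha p X.
Proof.
move=> X1 /andP[al0 al1] p0; rewrite /tooth_width /tooth_gap.
have pap : p <= p / alpha by rewrite ler_pdivlMr//; nra.
apply: ler_pM; [lra|exact: powR_ge0|lra|apply: ler_powR; lra].
Qed.

Lemma comb_constant_le alpha p X : 1 <= X -> 0 < alpha <= 1 ->
  6 * tooth_width X `^ (1 - alpha) +
  4 * tooth_width X * (X `^ p * tooth_gap alpha p X) `^ (1 - alpha) / tooth_gap alpha p X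
  <= 10 * X `^ (- (1 - alpha) / 2).
Proof.
move=> X1 /andP[al0 al1].
have X0 : 0 < X by lra.
have h1 : tooth_width X `^ (1 - alpha) <= X `^ (- (1 - alpha) / 2).
  rewrite /tooth_width powRM; [|lra|exact: powR_ge0].
  rewrite -powRrM (_ : - (1 / 2) * (1 - alpha) = - (1 - alpha) / 2); last by field.
  by rewrite ler_piMl ?powR_ge0// powR_base_le1//; lra.
have h2 : (X `^ p * tooth_gap alpha p X) `^ (1 - alpha) <=
    X `^ ((p / alpha - 1 / 2) * (1 - alpha)).
  rewrite mulr_tooth_gap// powRM; [|lra|exact: powR_ge0].
  by rewrite -powRrM ler_piMl ?powR_ge0// powR_base_le1//; lra.
have h3 : tooth_width X / tooth_gap alpha p X = 1 / 2 * X `^ (- (p / alpha) + p).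
  rewrite /tooth_width /tooth_gap invfM -powRN invrK.
  rewrite [LHS](_ : _ = 1 / 2 * (X `^ (- (1 / 2)) * X `^ (- (p / alpha - 1 / 2 - p)))).
    by rewrite powR_mul//; congr (_ * X `^ _); field; lra.
  by field.
rewrite [X in _ + X <= _](_ : _ =
  4 * (tooth_width X / tooth_gap alpha p X) *
    (X `^ p * tooth_gap alpha p X) `^ (1 - alpha)); last first.
  by set y := (tooth_gap _ _ _)^-1; ring.
rewrite h3.
have := ler_wpM2l (powR_ge0 X (- (p / alpha) + p)) h2.
rewrite powR_mul// (_ : - (p / alpha) + p + _ = - (1 - alpha) / 2); last by field; lra.
have := powR_ge0 X (- (1 - alpha) / 2); lra.
Qed.

(** The estimate at scale [X], with powers of [X] collected;
    [3840 = 128 * 10 * 3]. *)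
Lemma scale_exponent_le alpha p s A C X : 0 < X -> 0 < alpha -> 0 < A ->
  C <= 10 * X `^ (- (1 - alpha) / 2) ->
  (packet_width X / 2) ^+ 2 * (X `^ p * (2 * tooth_width X)) <=
    A * C * (3 * packet_freq alpha p X `^ (2 * s) * packet_width X) ->
  X `^ (p + (1 - alpha) / 2 - s * (2 * p / alpha + 1)) <= 3840 * A.
Proof.
move=> X0 al0 A0 CX h.
have K0 : 0 <= 3 * packet_freq alpha p X `^ (2 * s) * packet_width X.
  by rewrite !mulr_ge0 ?powR_ge0.
have {h} := le_trans h (ler_wpM2r K0 (ler_wpM2l (ltW A0) CX)).
rewrite exprMn packet_width_sqr// /tooth_width.
rewrite [leLHS](_ : _ = 128^-1 * (X `^ 1 * X `^ p * X `^ (- (1 / 2)))); last first.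
  by rewrite powRr1 ?(ltW X0)//; field.
rewrite [leRHS](_ : _ = 30 * A * (X `^ (- (1 - alpha) / 2) *
    X `^ ((p / alpha + 1 / 2) * (2 * s)) * X `^ (1 / 2))); last first.
  by rewrite /packet_freq -powRrM /packet_width; ring.
rewrite !powR_mul//; set u := 1 + p + _; set v := _ + 1 / 2.
move=> h; have := ler_wpM2r (powR_ge0 X (- v)) h.
rewrite -(mulrA 128^-1) -(mulrA (30 * A)) !powR_mul// subrr powRr0.
rewrite (_ : u - v = p + (1 - alpha) / 2 - s * (2 * p / alpha + 1)); last first.
  by rewrite /u /v; field; lra.
by lra.
Qed.

(** The packet focuses on the [j]-th tooth at the [j]-th time of a block. *)
Lemma schroedinger_tooth_ge alpha p i j x (X := (2 ^ i)%:R `^ p^-1) : 0 < p ->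
  (j < 2 ^ i)%N -> tooth (tooth_gap alpha p X) (tooth_width X) j x ->
  packet_width X / 2 <= Normc.normc
    (schroedinger (tseq p (2 ^ i + j)) (packet (packet_width X) (packet_freq alpha p X)) x).
Proof.
move=> p0 ji xj.
have M0 : 0 < (2 ^ i)%:R :> R by rewrite ltr0n expn_gt0.
have X0 : 0 < X by exact: powR_gt0.
have XM : X `^ p = (2 ^ i)%:R.
  by rewrite /X -powRrM mulVf ?gt_eqF// powRr1// ltW.
have tE : tseq p (2 ^ i + j) = j.+1%:R * (64^-1 * X^-1 / X `^ p).
  by rewrite tseqE// XM powRN.
apply: schroedinger_packet_ge; first exact: powR_gt0.
  rewrite -tooth_widthE tE [2 * _ * _](_ : _ = j.+1%:R * tooth_gap alpha p X); last first.
    by rewrite -tooth_gapE//; ring.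
  move: xj; rewrite /tooth/= in_itv/= => /andP[x1 x2].
  by rewrite ler_norml; apply/andP; split; lra.
rewrite packet_width_sqr// tE XM ger0_norm; last first.
  by rewrite !mulr_ge0 ?invr_ge0// ltW.
rewrite mulrCA ler_piMr ?mulr_ge0 ?invr_ge0 ?(ltW X0)//.
by rewrite ler_pdivrMr// mul1r ler_nat.
Qed.

(** The maximal estimate for the times [tseq p], tested on the packet and the
    comb of scale [X = 2 ^ (i / p)]. *)
Lemma maximal_estimate_scale alpha p s A i (X := (2 ^ i)%:R `^ p^-1) :
  0 < alpha <= 1 -> 0 < p -> p <= alpha / 2 -> 0 <= s <= 1 -> 0 < A ->
  (forall (f : R -> R[i]) (mu : {measure set (measurableTypeR R) -> \bar R}) (C : R),
    schwartz f -> alpha_dim_with alpha mu C ->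
    (\int[mu]_(x in ball (0 : R)%R 1%R)
       ereal_sup (range (fun k : nat =>
         (Normc.normc (schroedinger (tseq p k) f x) ^+ 2)%:E))
     <= A%:E * C%:E * sobolev_normsq s f)%E) ->
  X `^ (p + (1 - alpha) / 2 - s * (2 * p / alpha + 1)) <= 3840 * A.
Proof.
move=> al01 p0 pal s01 A0 est; have /andP[al0 al1] := al01.
have M1 : 1 <= (2 ^ i)%:R :> R by rewrite ler1n expn_gt0.
have X1 : 1 <= X by apply: powR_ge1 => //; rewrite invr_ge0 ltW.
have X0 : 0 < X by exact: lt_le_trans X1.
have XM : X `^ p = (2 ^ i)%:R.
  by rewrite /X -powRrM mulVf ?gt_eqF// powRr1//; lra.
pose lam := packet_width X; pose N := packet_freq alpha p X.
pose l := tooth_width X; pose D := tooth_gap alpha p X.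
have lam0 : 0 < lam by exact: powR_gt0.
have pa : p / alpha <= 1 / 2 by rewrite ler_pdivrMr; lra.
have pa0 : 0 < p / alpha by exact: divr_gt0.
have N1 : 1 <= N by apply: powR_ge1 => //; lra.
have lN : lam <= N by apply: ler_powR => //; lra.
have l0 : 0 < l by rewrite mulr_gt0// powR_gt0.
have D0 : 0 < D by rewrite mulr_gt0// powR_gt0.
have lD : l <= D by exact: tooth_width_le_gap.
have L32 : (2 ^ i)%:R * D <= 32^-1.
  by rewrite -XM mulr_tooth_gap// ler_piMr// powR_le1//; lra.
have l64 : l <= 64^-1 by rewrite /l ler_piMr// powR_le1//; lra.
set C := 6 * l `^ (1 - alpha) + 4 * l * ((2 ^ i)%:R * D) `^ (1 - alpha) / D.
have CE : C <= 10 * X `^ (- (1 - alpha) / 2).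
  by rewrite /C -XM; exact: comb_constant_le.
have C0 : 0 <= C.
  rewrite addr_ge0//; first by rewrite mulr_ge0 ?powR_ge0.
  rewrite divr_ge0 ?(ltW D0)// mulr_ge0 ?powR_ge0//.
  by rewrite mulr_ge0 ?(ltW l0).
have Cdim : alpha_dim_with alpha (comb D l (2 ^ i)) C.
  by apply: comb_alpha_dim => //; rewrite ?expn_gt0// (ltW al0).
have teeth j : (j < 2 ^ i)%N -> tooth D l j `<=` ball (0 : R) 1.
  move=> ji x; rewrite /tooth/= in_itv/= => /andP[x1 x2].
  have h1 : 0 <= j.+1%:R * D by rewrite mulr_ge0// ltW.
  have h2 : j.+1%:R * D <= (2 ^ i)%:R * D by rewrite ler_wpM2r ?(ltW D0)// ler_nat.
  by rewrite ball_itv/= in_itv/=; apply/andP; split; lra.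
have sob := sobolev_packet_le lam0 N1 lN s01.
have AC0 : (0 <= A%:E * C%:E)%E by rewrite -EFinM lee_fin mulr_ge0// ltW.
have := le_trans (est _ _ _ (schwartz_packet N lam0) Cdim) (lee_wpmul2l AC0 sob).
have lower := @comb_integral_ge _ D l (2 ^ i) ((lam / 2) ^+ 2) (ball (0 : R) 1)
  (fun x => ereal_sup (range (fun k : nat =>
     (Normc.normc (schroedinger (tseq p k) (packet lam N) x) ^+ 2)%:E)))
  l0 (sqr_ge0 _) (measurable_ball _ _) teeth.
move/(le_trans (lower _ _)); rewrite -!EFinM lee_fin -XM => fin.
apply: (scale_exponent_le X0 al0 A0 CE); apply: fin => [x|j x ji xj].
  apply: ereal_sup_ge; eexists; first by exists 0%N.
  by rewrite lee_fin sqr_ge0.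
apply: ereal_sup_ge; eexists; first by exists (2 ^ i + j)%N.
have h := schroedinger_tooth_ge p0 ji xj.
rewrite lee_fin lerXn2r ?nnegrE//; first by rewrite divr_ge0// ltW.
by apply: le_trans h; rewrite divr_ge0// ltW.
Qed.

Lemma pow2_powR_unbounded a c : 0 < a -> exists i, c < (2 ^ i)%:R `^ a.
Proof.
move=> a0; exists (Num.truncn (`|c| `^ a^-1)).+1.
apply: (le_lt_trans (ler_norm c)).
set q := `|c| `^ a^-1.
have -> : `|c| = q `^ a by rewrite /q -powRrM mulVf ?gt_eqF// powRr1.
apply: gt0_ltr_powR => //; rewrite ?nnegrE ?powR_ge0//.
apply: (lt_trans (truncnS_gt _)).
by rewrite ltr_nat ltn_expl.
Qed.

End lower_bound.

(** * The critical exponent *)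

Theorem theorem1p2 (R : realType) (alpha r : R)
    (halpha : 1 / 2 <= alpha <= 1) (hr : 0 < r) :
  (((1 - alpha) / 2 +
    Num.min ((2 * alpha - 1) / 4)
            (r * (2 * alpha - 1) / (2 * r + alpha)))%:E
   <= s_max_crit alpha r)%E.
Proof.
apply: le_ereal_inf_tmp => _ [s [s0 est] <-]; rewrite lee_fin leNgt; apply/negP => slt.
have /andP[al0 al1] := halpha.
(* beyond [alpha / 2] the teeth would leave the unit ball, and the bound does not
   grow *)
pose p := Num.min r (alpha / 2).
have p0 : 0 < p by rewrite lt_min hr/=; lra.
have pr : p <= r by rewrite /p ge_min lexx.
have pal : p <= alpha / 2 by rewrite /p ge_min lexx orbT.
have sp : s < (1 - alpha) / 2 + p * (2 * alpha - 1) / (2 * p + alpha).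
  apply: (lt_le_trans slt); rewrite lerD2l.
  have [ra|ar] := leP r (alpha / 2).
    have -> : p = r by exact: min_l.
    by rewrite ge_min lexx orbT.
  have -> : p = alpha / 2 by apply: min_r; exact: ltW.
  rewrite ge_min; apply/orP; left.
  by rewrite le_eqVlt; apply/orP; left; apply/eqP; field; lra.
have s1 : s <= 1.
  have : p * (2 * alpha - 1) / (2 * p + alpha) <= 1 / 2.
    by rewrite ler_pdivrMr; [nra|lra].
  by lra.
have e0 : 0 < p + (1 - alpha) / 2 - s * (2 * p / alpha + 1).
  have q0 : 0 < 2 * p / alpha + 1 by rewrite addr_gt0// divr_gt0; lra.
  rewrite subr_gt0 -ltr_pdivlMr//.
  apply: (lt_le_trans sp); rewrite le_eqVlt; apply/orP; left; apply/eqP.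
  by field; lra.
have [A A0 estA] := est _ (weak_lr_tseq p0 pr).
have [m] := pow2_powR_unbounded (3840 * A) (divr_gt0 e0 p0).
rewrite [_ / p]mulrC powRrM ltNge => /negP; apply.
apply: (@maximal_estimate_scale R alpha p s A m _ p0 pal _ A0 estA).
  by apply/andP; split; lra.
by rewrite s0.
Qed.
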